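(* Let $\mathbb{F}$ be a field of characteristic different from $2$ and $3$. The map $\zeta_s:\mathcal{A}^c_{\mathrm{st}}/SL(V)\to\Gamma_{\mathrm{Eisenstein}}$ induced by $$m\mapsto(\tilde p_3(m),\tilde p_2(m),\mathrm{Disc}(Q_m),\mathrm{Inv}_m)$$ is surjective.
   Context: $V$ is a two-dimensional $\mathbb{F}$-vector space. $L=\Lambda^2(V^* )$ is the one-dimensional space of antisymmetric bilinear forms on $V$, $L^r$ its $r$-th tensor power, with $L^r\otimes L^s=L^{r+s}$. $\mathcal{A}^c$ is the set of symmetric bilinear maps $m:V\times V\to V$. $GL(V)$, and hence $SL(V)$, acts on $\mathcal{A}^c$ by $(g\cdot m)(v,w)=g\big(m(g^{-1}v,g^{-1}w)\big)$. The set of stable algebras $\mathcal{A}^c_{\mathrm{st}}$ is the set of $m\in\mathcal{A}^c$ for which there is an $SL(V)$-invariant homogeneous polynomial $F$ of positive degree on $\mathcal{A}^c$ (invariant as a polynomial, i.e. also after extension of scalars to an algebraic closure) with $F(m)\ne0$. Let $(e_1,e_2)$ be a basis of $V$ with dual basis $(\epsilon_1,\epsilon_2)$, put $\omega=\epsilon_1\wedge\epsilon_2$, and write $m(e_1,e_1)=ae_1+be_2$, $m(e_2,e_2)=ce_1+de_2$, $m(e_1,e_2)=ee_1+fe_2$. The fundamental cubic is $Q_m(v)=m(v,v)\wedge v$; thus $Q_m(xe_1+ye_2)=q(x,y)\,e_1\wedge e_2$ with $q(x,y)=-bx^3+(a-2f)x^2y+(2e-d)xy^2+cy^3$. Writing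 $q=A_0x^3+B_0x^2y+C_0xy^2+D_0y^3$, $\mathrm{Disc}(Q_m)=(18A_0B_0C_0D_0+B_0^2C_0^2-4A_0C_0^3-4B_0^3D_0-27A_0^2D_0^2)\,\omega^2\in L^2$. Put $\mu(x,y)=q_{xx}q_{yy}-q_{xy}^2$, $G(x,y)=q_x\mu_y-q_y\mu_x$, $\tau=(d+e,-(a+f))$. Define $\tilde p_3(m)=-8q(\tau)\omega^2\in L^2$, $\tilde p_2(m)=\mu(\tau)\omega^2\in L^2$, $\mathrm{Inv}_m=\frac1{54}G(\tau)\omega^3\in L^3$ (all independent of the basis and $SL(V)$-invariant). $\Gamma_{\mathrm{Eisenstein}}=\{(A,B,D,C)\in(L^2\times L^2\times L^2\times L^3)\setminus\{0\}:27DA^2+4B^3+2^43^6C^2=0\}$. *)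

(* Defs.v *)
From mathcomp Require Export all_boot all_order all_algebra.
From mathcomp Require Export mpoly.
From mathcomp Require Import ring.
From mathcomp Require Export boolp classical_sets functions.

Set Implicit Arguments.
Unset Strict Implicit.
Unset Printing Implicit Defensive.

Import GRing.Theory.
Local Open Scope ring_scope.
Local Open Scope classical_set_scope.

Section Algebras.
Variables (F : fieldType) (V : vectType F).
Implicit Types (e : 2.-tuple V) (g : 'End(V)) (m : V -> V -> V).

Definition Ac : set (V -> V -> V) :=
  [set m | bilinear_for *:%R *:%R m /\ forall v w, m v w = m w v].

(* The determinant is that of the matrix of g in the basis e; it does not depend
   on e. *)
Definition SL e : set 'End(V) :=
  [set g | \det (\matrix_(i < 2, j < 2) coord e i (g (tnth e j))) = 1].

Definition act g m : V -> V -> V :=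
  fun v w => g (m ((g^-1)%VF v) ((g^-1)%VF w)).

Definition SLorbit e m : set (V -> V -> V) := [set act g m | g in SL e].

Definition coef_a e m : F := coord e 0 (m (tnth e 0) (tnth e 0)).
Definition coef_b e m : F := coord e 1 (m (tnth e 0) (tnth e 0)).
Definition coef_c e m : F := coord e 0 (m (tnth e 1) (tnth e 1)).
Definition coef_d e m : F := coord e 1 (m (tnth e 1) (tnth e 1)).
Definition coef_e e m : F := coord e 0 (m (tnth e 0) (tnth e 1)).
Definition coef_f e m : F := coord e 1 (m (tnth e 0) (tnth e 1)).

(* Linear coordinates on the six-dimensional space Ac. *)
Definition Ac_coord e m : 'I_6 -> F :=
  tnth [tuple coef_a e m; coef_b e m; coef_c e m;
              coef_d e m; coef_e e m; coef_f e m].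

Definition SL_invariant e (P : {mpoly F[6]}) : Prop :=
  forall g m, SL e g -> Ac m ->
    P.@[Ac_coord e (act g m)] = P.@[Ac_coord e m].

End Algebras.

Definition std_basis (K : fieldType) : 2.-tuple 'rV[K]_2 :=
  [tuple delta_mx 0 0; delta_mx 0 1].

(* Over an algebraic closure iota : F -> K, the space V (x) K with its basis
   e (x) 1 is identified with K^2 and its standard basis. *)
Definition SL_invariant_poly (F : fieldType) (V : vectType F) (e : 2.-tuple V)
    (P : {mpoly F[6]}) : Prop :=
  SL_invariant e P /\
  forall (K : closedFieldType) (iota : {rmorphism F -> K}),
    integralRange iota -> SL_invariant (std_basis K) (map_mpoly iota P).

Definition Ac_st (F : fieldType) (V : vectType F) (e : 2.-tuple V) :
    set (V -> V -> V) :=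
  [set m | Ac m /\ exists (n : nat) (P : {mpoly F[6]}),
     [/\ (0 < n)%N, P \is n.-homog, SL_invariant_poly e P
       & P.@[Ac_coord e m] != 0]].

Definition Ac_st_quotient (F : fieldType) (V : vectType F) (e : 2.-tuple V) :
    set (set (V -> V -> V)) := SLorbit e @` Ac_st e.

Section TensorPowers.
Variables (F : fieldType) (V : vectType F).

(* L^r is realised inside the 2r-fold tensor power of V^* : its elements are
   the functions of r pairs of vectors that are antisymmetric bilinear forms
   in each pair. *)
Definition pairform (r : nat) := ('I_r -> V * V) -> F.

Definition Lpow (r : nat) : set (pairform r) :=
  [set T | forall (u : 'I_r -> V * V) (i : 'I_r),
     let B v w := T [eta u with i |-> (v, w)] in
     bilinear_for *%R *%R B /\ forall v w, B v w = - B w v].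

Definition Ltens (r s : nat) (S : pairform r) (T : pairform s) :
    pairform (r + s) :=
  fun u => S (fun i => u (lshift s i)) * T (fun j => u (rshift r j)).

Definition omega (e : 2.-tuple V) (v w : V) : F :=
  coord e 0 v * coord e 1 w - coord e 1 v * coord e 0 w.

Definition omega_pow (e : 2.-tuple V) (r : nat) : pairform r :=
  fun u => \prod_(i < r) omega e (u i).1 (u i).2.

Definition Lscale (r : nat) (k : F) (T : pairform r) : pairform r :=
  fun u => k * T u.

Definition Gamma_Eisenstein :
    set (pairform 2 * pairform 2 * pairform 2 * pairform 3) :=
  [set z : pairform 2 * pairform 2 * pairform 2 * pairform 3 |
     let: (A, B, D, C) := z in
     [/\ [/\ Lpow A, Lpow B, Lpow D & Lpow C],
         z <> (cst 0, cst 0, cst 0, cst 0)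
       & forall u : 'I_6 -> V * V,
           27%:R * Ltens (Ltens D A) A u + 4%:R * Ltens (Ltens B B) B u
             + (2 ^ 4 * 3 ^ 6)%:R * Ltens C C u = 0]].

End TensorPowers.
Arguments omega_pow {F V} e r u.

Section Invariants.
Variables (F : fieldType) (V : vectType F) (e : 2.-tuple V).
Variable m : V -> V -> V.
Local Notation a := (coef_a e m).
Local Notation b := (coef_b e m).
Local Notation c := (coef_c e m).
Local Notation d := (coef_d e m).
Local Notation e' := (coef_e e m).
Local Notation f := (coef_f e m).

Definition A0 : F := - b.
Definition B0 : F := a - 2%:R * f.
Definition C0 : F := 2%:R * e' - d.
Definition D0 : F := c.

Definition q : {mpoly F[2]} :=
  A0 *: 'X_0 ^+ 3 + B0 *: ('X_0 ^+ 2 * 'X_1)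
    + C0 *: ('X_0 * 'X_1 ^+ 2) + D0 *: 'X_1 ^+ 3.

(* q represents the fundamental cubic m(v, v) /\ v in the basis e; here the
   bivector v /\ w is omega e v w times e_1 /\ e_2. *)
Lemma fundamental_cubicE (he : basis_of fullv e) (hm : Ac m) (v : V) :
  omega e (m v v) v = q.@[fun i => coord e i v].
Proof.
have [[lin1 lin2] sym] := hm.
have vE : v = coord e 0 v *: tnth e 0 + coord e 1 v *: tnth e 1.
  rewrite [LHS](coord_basis he (memvf v)) !big_ord_recl big_ord0 addr0.
  by rewrite !(tnth_nth 0); congr (_ + coord _ _ _ *: _); exact/val_inj.
set x := coord e 0 v in vE *; set y := coord e 1 v in vE *.
have mE i : coord e i (m v v) =
    x ^+ 2 * coord e i (m (tnth e 0) (tnth e 0))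
    + 2%:R * x * y * coord e i (m (tnth e 0) (tnth e 1))
    + y ^+ 2 * coord e i (m (tnth e 1) (tnth e 1)).
  have mDl u1 u2 w k l : m (k *: u1 + l *: u2) w = k *: m u1 w + l *: m u2 w.
    have lin1_0 : m 0 w = 0.
      have := lin1 w (-1) 0 0.
      by rewrite scaler0 addr0 /= scaleN1r addNr.
    rewrite [LHS](lin1 w) /=; congr (_ + _).
    by rewrite -[l *: u2 in LHS]addr0 [LHS](lin1 w) /= lin1_0 addr0.
  rewrite vE mDl ![m _ (_ + _)]sym !mDl (sym (tnth e 1) (tnth e 0)).
  rewrite !linearD !linearZ /=; ring.
rewrite /omega !mE -/x -/y /q !(mevalD, mevalZ, mevalM, rmorphXn, mevalXU) /= -/x -/y.
rewrite /A0 /B0 /C0 /D0 /coef_a /coef_b /coef_c /coef_d /coef_e /coef_f; ring.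
Qed.

Definition mu : {mpoly F[2]} :=
  q^`M(0)^`M(0) * q^`M(1)^`M(1) - q^`M(0)^`M(1) ^+ 2.

Definition G : {mpoly F[2]} := q^`M(0) * mu^`M(1) - q^`M(1) * mu^`M(0).

Definition tau : 'I_2 -> F := tnth [tuple d + e'; - (a + f)].

Definition DiscQ : pairform V 2 :=
  Lscale (18%:R * A0 * B0 * C0 * D0 + B0 ^+ 2 * C0 ^+ 2 - 4%:R * A0 * C0 ^+ 3
            - 4%:R * B0 ^+ 3 * D0 - 27%:R * A0 ^+ 2 * D0 ^+ 2)
         (omega_pow e 2).

Definition p3 : pairform V 2 := Lscale (- 8%:R * q.@[tau]) (omega_pow e 2).

Definition p2 : pairform V 2 := Lscale mu.@[tau] (omega_pow e 2).

Definition Inv : pairform V 3 := Lscale (54%:R^-1 * G.@[tau]) (omega_pow e 3).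

Definition invariants := (p3, p2, DiscQ, Inv).

End Invariants.

(* Main.v *)
From HB Require Import structures.
Require Import Defs.
From mathcomp Require Import ring closed_field.

Set Implicit Arguments.
Unset Strict Implicit.
Unset Printing Implicit Defensive.

Import GRing.Theory.
Local Open Scope ring_scope.
Local Open Scope classical_set_scope.

(** An algebra [m] carries the same information as the pair made of its
    fundamental cubic [q] and the vector [tau] that represents the trace form
    [v |-> tr m(v, -)] through [omega]: away from characteristic 3 the passage
    from the six structure constants to the four coefficients of [q] and the two
    coordinates of [tau] is a linear isomorphism, and it commutes with the
    action of the special linear group. The four invariants are then, up to constants, the covariants
    [q], Hessian and Jacobian of a binary cubic evaluated at [tau], together
    with its discriminant, and the equation of the target is the classical
    syzygy [jacobian ^ 2 + hess ^ 3 + 432 disc cubic ^ 2 = 0] between them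
    ([cubic_syzygy]).

    Surjectivity. Given scalars [(al, be, de, ga)] on the hypersurface, one
    writes down a cubic with the right values ([eisenstein_surj]). If [al] is
    nonzero, take [tau = (1, 0)] and a cubic without [x^2 y] term: the values
    of [q], of the Hessian and of the Jacobian at [tau] give successively the
    three other coefficients, and the syzygy forces the discriminant. If [al]
    vanishes but [be] does not, the equation says that [- be] is four times the
    square of [s = - 27 ga / be], and [s x^2 y + D y^3] with [tau = (1, 0)]
    works. If both vanish then so does [ga], and [tau = 0] with the cubic
    [x^2 y + D y^3] works. The algebra obtained is stable because one of its
    four invariants is nonzero and each is an invariant homogeneous polynomial
    ([stable_of_invariant]).

    The map lands in the target. The only issue is that the invariants of a
    stable algebra do not all vanish, which is the easy half of the
    Hilbert-Mumford criterion made explicit. If they vanish there is a nonzero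
    vector [v], proportional to [tau], which is a double root of [q]
    ([null_direction]): this is [tau] itself if [tau] is nonzero, and otherwise
    a multiple root of [q], which is rational. In a unimodular basis starting
    with [v] three structure constants vanish ([null_form]), and the remaining
    ones are multiplied by positive powers of [t] under the diagonal matrices
    of entries [t] and [t^-1]. An invariant homogeneous polynomial of positive
    degree therefore vanishes there, provided that the field is infinite
    ([unstable_of_invariants0]). If the ground field is finite, it is countable,
    so it has an algebraic closure, over which the invariance persists by
    definition and the same argument applies. *)

(** * Covariants of a binary cubic in terms of structure constants *)

Lemma tnth6E (T : Type) (t0 t1 t2 t3 t4 t5 : T)
    (t := [tuple t0; t1; t2; t3; t4; t5]) :
  (tnth t 0 = t0) * (tnth t 1 = t1) * (tnth t 2%:R = t2) * (tnth t 3%:R = t3)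
  * (tnth t 4%:R = t4) * (tnth t 5%:R = t5).
Proof. by []. Qed.

Lemma eq_fun6 (T : Type) (c c' : 'I_6 -> T) :
  c 0 = c' 0 -> c 1 = c' 1 -> c 2%:R = c' 2%:R -> c 3%:R = c' 3%:R ->
  c 4%:R = c' 4%:R -> c 5%:R = c' 5%:R -> c = c'.
Proof.
move=> E0 E1 E2 E3 E4 E5; apply/funext => -[[|[|[|[|[|[|//]]]]]] lt_i].
- by rewrite (_ : Ordinal lt_i = 0) //; exact/val_inj.
- by rewrite (_ : Ordinal lt_i = 1) //; exact/val_inj.
- by rewrite (_ : Ordinal lt_i = 2%:R) //; exact/val_inj.
- by rewrite (_ : Ordinal lt_i = 3%:R) //; exact/val_inj.
- by rewrite (_ : Ordinal lt_i = 4%:R) //; exact/val_inj.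
- by rewrite (_ : Ordinal lt_i = 5%:R) //; exact/val_inj.
Qed.

Section Coordinates.
Variable R : comNzRingType.
Implicit Types (c : 'I_6 -> R) (x y z u : R).

(** The vector [c] lists the structure constants in the order a, b, c, d, e, f
    of [Ac_coord]. *)
Definition cubA c : R := - c 1.
Definition cubB c : R := c 0 - 2%:R * c 5%:R.
Definition cubC c : R := 2%:R * c 4%:R - c 3%:R.
Definition cubD c : R := c 2%:R.
Definition tau0 c : R := c 3%:R + c 4%:R.
Definition tau1 c : R := - (c 0 + c 5%:R).

Definition cubic c x y : R :=
  cubA c * x ^+ 3 + cubB c * (x ^+ 2 * y) + cubC c * (x * y ^+ 2)
  + cubD c * y ^+ 3.
Definition cubic_x c x y : R :=
  3%:R * cubA c * x ^+ 2 + 2%:R * cubB c * (x * y) + cubC c * y ^+ 2.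
Definition cubic_y c x y : R :=
  cubB c * x ^+ 2 + 2%:R * cubC c * (x * y) + 3%:R * cubD c * y ^+ 2.

Definition hess0 c : R := 12%:R * cubA c * cubC c - 4%:R * cubB c ^+ 2.
Definition hess1 c : R := 36%:R * cubA c * cubD c - 4%:R * cubB c * cubC c.
Definition hess2 c : R := 12%:R * cubB c * cubD c - 4%:R * cubC c ^+ 2.

Definition hess c x y : R :=
  hess0 c * x ^+ 2 + hess1 c * (x * y) + hess2 c * y ^+ 2.
Definition hess_x c x y : R := 2%:R * hess0 c * x + hess1 c * y.
Definition hess_y c x y : R := hess1 c * x + 2%:R * hess2 c * y.
Definition jacobian c x y : R :=
  cubic_x c x y * hess_y c x y - cubic_y c x y * hess_x c x y.

Definition disc c : R :=
  18%:R * cubA c * cubB c * cubC c * cubD c + cubB c ^+ 2 * cubC c ^+ 2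
  - 4%:R * cubA c * cubC c ^+ 3 - 4%:R * cubB c ^+ 3 * cubD c
  - 27%:R * cubA c ^+ 2 * cubD c ^+ 2.

Definition cubic_tau c := cubic c (tau0 c) (tau1 c).
Definition hess_tau c := hess c (tau0 c) (tau1 c).
Definition jacobian_tau c := jacobian c (tau0 c) (tau1 c).

(** Cayley's syzygy between the covariants of a binary cubic; the equation of
    the target is the case where [(x, y)] is [tau]. *)
Lemma cubic_syzygy c x y :
  jacobian c x y ^+ 2 + hess c x y ^+ 3 + 432%:R * disc c * cubic c x y ^+ 2 = 0.
Proof.
rewrite /jacobian /hess_x /hess_y /cubic_x /cubic_y /hess /hess0 /hess1 /hess2.
rewrite /disc /cubic.
move: (cubA c) (cubB c) (cubC c) (cubD c) => A B C D.
ring.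
Qed.

(** Structure constants in the basis [x e_1 + y e_2, z e_1 + u e_2]: the p's and
    q's are the coordinates, in the old basis, of the products of the new basis
    vectors, and the inverse of the base change is written as the adjugate,
    which is right when the determinant is 1. *)
Definition change_basis x y z u c : 'I_6 -> R :=
  let p11 := x ^+ 2 * c 0 + 2%:R * (x * y) * c 4%:R + y ^+ 2 * c 2%:R in
  let q11 := x ^+ 2 * c 1 + 2%:R * (x * y) * c 5%:R + y ^+ 2 * c 3%:R in
  let p22 := z ^+ 2 * c 0 + 2%:R * (z * u) * c 4%:R + u ^+ 2 * c 2%:R in
  let q22 := z ^+ 2 * c 1 + 2%:R * (z * u) * c 5%:R + u ^+ 2 * c 3%:R in
  let p12 := x * z * c 0 + (x * u + y * z) * c 4%:R + y * u * c 2%:R in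
  let q12 := x * z * c 1 + (x * u + y * z) * c 5%:R + y * u * c 3%:R in
  tnth [tuple u * p11 - z * q11; x * q11 - y * p11; u * p22 - z * q22;
              x * q22 - y * p22; u * p12 - z * q12; x * q12 - y * p12].

(** The cubic is composed with the substitution, its middle coefficients being
    polarizations, and [tau] is transformed by the inverse matrix. *)
Section Covariance.
Variables (x y z u : R) (c : 'I_6 -> R).
Hypothesis det1 : x * u - y * z = 1.
Let c' := change_basis x y z u c.

Lemma cubA_change_basis : cubA c' = cubic c x y.
Proof. rewrite /cubic /cubA /cubB /cubC /cubD /c' /change_basis !tnth6E; ring. Qed.
Lemma cubB_change_basis : cubB c' = z * cubic_x c x y + u * cubic_y c x y.
Proof.
rewrite /cubic_x /cubic_y /cubA /cubB /cubC /cubD /c' /change_basis !tnth6E.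
ring.
Qed.
Lemma cubC_change_basis : cubC c' = x * cubic_x c z u + y * cubic_y c z u.
Proof.
rewrite /cubic_x /cubic_y /cubA /cubB /cubC /cubD /c' /change_basis !tnth6E.
ring.
Qed.
Lemma cubD_change_basis : cubD c' = cubic c z u.
Proof. rewrite /cubic /cubA /cubB /cubC /cubD /c' /change_basis !tnth6E; ring. Qed.
Lemma tau0_change_basis : tau0 c' = u * tau0 c - z * tau1 c.
Proof.
have -> : tau0 c' = (x * u - y * z) * (u * tau0 c - z * tau1 c).
  by rewrite /tau0 /tau1 /c' /change_basis !tnth6E; ring.
by rewrite det1 mul1r.
Qed.
Lemma tau1_change_basis : tau1 c' = x * tau1 c - y * tau0 c.
Proof.
have -> : tau1 c' = (x * u - y * z) * (x * tau1 c - y * tau0 c).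
  by rewrite /tau0 /tau1 /c' /change_basis !tnth6E; ring.
by rewrite det1 mul1r.
Qed.

Lemma cubic_change_basis r s :
  cubic c' r s = cubic c (x * r + z * s) (y * r + u * s).
Proof.
rewrite {1}/cubic cubA_change_basis cubB_change_basis cubC_change_basis.
rewrite cubD_change_basis /cubic /cubic_x /cubic_y; ring.
Qed.

(** Both sides differ by the square of the determinant; inserting that square
    turns the claim into a polynomial identity, free of side conditions. The
    same device serves for the discriminant and the Jacobian. *)
Lemma hess_change_basis r s :
  hess c' r s = hess c (x * r + z * s) (y * r + u * s).
Proof.
set rhs := RHS.
have -> : rhs = (x * u - y * z) ^+ 2 * rhs by rewrite det1 expr1n mul1r.
rewrite {}/rhs {1}/hess /hess0 /hess1 /hess2.
rewrite cubA_change_basis cubB_change_basis cubC_change_basis cubD_change_basis.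
rewrite /hess /hess0 /hess1 /hess2 /cubic /cubic_x /cubic_y.
move: (cubA c) (cubB c) (cubC c) (cubD c) => A B C D.
ring.
Qed.

Lemma disc_change_basis : disc c' = disc c.
Proof.
have -> : disc c = (x * u - y * z) ^+ 6 * disc c by rewrite det1 expr1n mul1r.
rewrite {1}/disc.
rewrite cubA_change_basis cubB_change_basis cubC_change_basis cubD_change_basis.
rewrite /disc /cubic /cubic_x /cubic_y.
move: (cubA c) (cubB c) (cubC c) (cubD c) => A B C D.
ring.
Qed.

Lemma jacobian_change_basis r s :
  jacobian c' r s = jacobian c (x * r + z * s) (y * r + u * s).
Proof.
set rhs := RHS.
have -> : rhs = (x * u - y * z) ^+ 3 * rhs by rewrite det1 expr1n mul1r.
rewrite {}/rhs {1}/jacobian /hess_x /hess_y /cubic_x /cubic_y /hess0 /hess1 /hess2.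
rewrite cubA_change_basis cubB_change_basis cubC_change_basis cubD_change_basis.
rewrite /jacobian /hess_x /hess_y /hess0 /hess1 /hess2 /cubic /cubic_x /cubic_y.
move: (cubA c) (cubB c) (cubC c) (cubD c) => A B C D.
ring.
Qed.

Lemma tau_change_basis :
  (x * tau0 c' + z * tau1 c' = tau0 c) * (y * tau0 c' + u * tau1 c' = tau1 c).
Proof.
rewrite tau0_change_basis tau1_change_basis.
have det1' : x * u = 1 + y * z by rewrite -det1 subrK.
by split; ring: det1'.
Qed.

Lemma invariants_change_basis :
  [/\ cubic_tau c' = cubic_tau c, hess_tau c' = hess_tau c,
      jacobian_tau c' = jacobian_tau c & disc c' = disc c].
Proof.
rewrite /cubic_tau /hess_tau /jacobian_tau.
rewrite cubic_change_basis hess_change_basis jacobian_change_basis.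
by rewrite !tau_change_basis disc_change_basis.
Qed.
End Covariance.
End Coordinates.

(** * Null forms *)

Section NullForms.
Variable K : fieldType.
Hypotheses (nz2 : 2%:R != 0 :> K) (nz3 : 3%:R != 0 :> K).
Implicit Types (c : 'I_6 -> K) (x y z u : K).

Lemma complete_basis x y : (x != 0) || (y != 0) ->
  exists z u, x * u - y * z = 1.
Proof.
have [-> /= y0|x0 _] := eqVneq x 0.
  by exists (- y^-1), 0; rewrite mul0r mulrN opprK add0r divff.
by exists 0, x^-1; rewrite mulr0 subr0 divff.
Qed.

(** A cubic of discriminant zero has a multiple root over the ground field. The
    vector [(9 A D - B C, 2 (B ^ 2 - 3 A C))] is one, since it kills both
    partial derivatives up to multiples of the discriminant, unless it is zero;
    in that case the root is triple and is read off from [B ^ 2 = 3 A C]. *)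
Lemma double_root_exists c : disc c = 0 ->
  exists x y, [/\ (x != 0) || (y != 0), cubic_x c x y = 0 & cubic_y c x y = 0].
Proof.
rewrite /disc /cubic_x /cubic_y.
move: (cubA c) (cubB c) (cubC c) (cubD c) => A B C D disc0.
set x := 9%:R * A * D - B * C; set y := 2%:R * (B ^+ 2 - 3%:R * A * C).
have [xy0|/norP [/negPn /eqP x0 /negPn /eqP y0]] := boolP ((x != 0) || (y != 0)).
  exists x, y; split=> //.
    by rewrite -(mulr0 (- 9%:R * A)) -disc0 /x /y; ring.
  by rewrite -(mulr0 (- 3%:R * B)) -disc0 /x /y; ring.
have dB : B ^+ 2 - 3%:R * A * C = 0.
  by apply/eqP; rewrite -(mulrI_eq0 _ (mulfI nz2)) -/y y0.
have [A0|A0] := eqVneq A 0.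
  have B0 : B = 0.
    by move/eqP: dB; rewrite A0 mulr0 mul0r subr0 sqrf_eq0 => /eqP.
  by exists 1, 0; rewrite oner_eq0 A0 B0; split=> //; ring.
exists (- B), (3%:R * A); split; first by rewrite mulf_neq0 ?orbT.
- by rewrite -(mulr0 (- 3%:R * A)) -dB; ring.
- by rewrite -(addr0 0) -{1}(mulr0 B) -{1}dB -(mulr0 (3%:R * A)) -x0 /x; ring.
Qed.

(** If [q] and its Hessian vanish at a point then so does the gradient of [q],
    because of the identity [y ^ 2 hess = 6 q q_xx - 4 q_x ^ 2] and the one
    with [x] and [y] exchanged. *)
Lemma tau_double_root c : cubic_tau c = 0 -> hess_tau c = 0 ->
  cubic_x c (tau0 c) (tau1 c) = 0 /\ cubic_y c (tau0 c) (tau1 c) = 0.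
Proof.
rewrite /cubic_tau /hess_tau; move: (tau0 c) (tau1 c) => x y q0 h0.
have nz4 : 4%:R != 0 :> K by rewrite (natrM _ 2 2) mulf_neq0.
split; apply/eqP; rewrite -sqrf_eq0 -(mulrI_eq0 _ (mulfI nz4)); apply/eqP.
- transitivity (6%:R * cubic c x y * (6%:R * cubA c * x + 2%:R * cubB c * y)
                 - y ^+ 2 * hess c x y); last by rewrite q0 h0 !mulr0 mul0r subr0.
  rewrite /cubic_x /cubic /hess /hess0 /hess1 /hess2; ring.
- transitivity (6%:R * cubic c x y * (2%:R * cubC c * x + 6%:R * cubD c * y)
                 - x ^+ 2 * hess c x y); last by rewrite q0 h0 !mulr0 mul0r subr0.
  rewrite /cubic_y /cubic /hess /hess0 /hess1 /hess2; ring.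
Qed.

Lemma null_direction c : cubic_tau c = 0 -> hess_tau c = 0 -> disc c = 0 ->
  exists x y, [/\ (x != 0) || (y != 0), cubic_x c x y = 0, cubic_y c x y = 0
                & x * tau1 c = y * tau0 c].
Proof.
move=> q0 h0 d0; have [t0|/norP[/negPn /eqP t0 /negPn /eqP t1]] :=
    boolP ((tau0 c != 0) || (tau1 c != 0)).
  have [qx qy] := tau_double_root q0 h0.
  by exists (tau0 c), (tau1 c); rewrite mulrC.
have [x [y [xy qx qy]]] := double_root_exists d0.
by exists x, y; rewrite t0 t1 !mulr0.
Qed.

(** With a first basis vector [v] that is a double root of [q] proportional to
    [tau], the coefficients [A] and [B] and the second coordinate of [tau]
    vanish; they are independent linear forms in the structure constants a, b
    and f. *)
Lemma null_form c : cubic_tau c = 0 -> hess_tau c = 0 -> disc c = 0 ->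
  exists x y z u, x * u - y * z = 1 /\
   let c' := change_basis x y z u c in [/\ c' 0 = 0, c' 1 = 0 & c' 5%:R = 0].
Proof.
move=> q0 h0 d0; have [x [y [xy qx qy txy]]] := null_direction q0 h0 d0.
have [z [u det1]] := complete_basis xy; exists x, y, z, u; split=> // c'.
have A'0 : cubA c' = 0.
  apply/eqP; rewrite (cubA_change_basis _ _ _ _ c) -(mulrI_eq0 _ (mulfI nz3)).
  have -> : 3%:R * cubic c x y = x * cubic_x c x y + y * cubic_y c x y.
    by rewrite /cubic /cubic_x /cubic_y; ring.
  by rewrite qx qy !mulr0 addr0.
have B'0 : cubB c' = 0 by rewrite (cubB_change_basis _ _ _ _ c) qx qy !mulr0 addr0.
have t'0 : tau1 c' = 0 by rewrite (tau1_change_basis _ det1) txy subrr.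
have c50 : c' 5%:R = 0.
  apply/eqP; rewrite -(mulrI_eq0 _ (mulfI nz3)).
  have -> : 3%:R * c' 5%:R = - tau1 c' - cubB c' by rewrite /tau1 /cubB; ring.
  by rewrite t'0 B'0 subr0 oppr0.
split=> //.
- by move: B'0; rewrite /cubB c50 mulr0 subr0.
- by apply/eqP; rewrite -oppr_eq0; apply/eqP; exact: A'0.
Qed.

End NullForms.

(** * Cubics with prescribed values of the covariants *)

Section PrescribedValues.
Variable K : fieldType.
Hypotheses (nz2 : 2%:R != 0 :> K) (nz3 : 3%:R != 0 :> K).
Implicit Type c : 'I_6 -> K.

(** The inverse of the linear map from structure constants to pairs made of a
    cubic and a vector; this is where 3 has to be invertible. *)
Lemma coords_of_cubic_tau (A B C D s t : K) : exists c,
  [/\ cubA c = A, cubB c = B, cubC c = C & cubD c = D] /\ tau0 c = s /\ tau1 c = t.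
Proof.
exists (tnth [tuple (B - 2%:R * t) / 3%:R; - A; D; (2%:R * s - C) / 3%:R;
                    (s + C) / 3%:R; (- t - B) / 3%:R]).
by rewrite /cubA /cubB /cubC /cubD /tau0 /tau1 !tnth6E; split; split; field.
Qed.

(** [cubic_syzygy] at [tau], multiplied by 4. *)
Lemma eisenstein_relation c :
  27%:R * disc c * (- 8%:R * cubic_tau c) ^+ 2 + 4%:R * hess_tau c ^+ 3
    + (2 ^ 4 * 3 ^ 6)%:R * (54%:R^-1 * jacobian_tau c) ^+ 2 = 0.
Proof.
have nz54 : 54%:R != 0 :> K.
  by rewrite (natrM _ 2 27) (natrX _ 3 3) mulf_neq0 ?expf_neq0.
rewrite -(mulr0 4%:R) -(cubic_syzygy c (tau0 c) (tau1 c)).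
rewrite /cubic_tau /hess_tau /jacobian_tau natrM !natrX; field.
exact: nz54.
Qed.

(** The three cases are the strata [al != 0], [al = 0 != be] and
    [al = be = 0] of the hypersurface. *)
Lemma eisenstein_surj (al be de ga : K) :
  27%:R * de * al ^+ 2 + 4%:R * be ^+ 3 + (2 ^ 4 * 3 ^ 6)%:R * ga ^+ 2 = 0 ->
  exists c, [/\ - 8%:R * cubic_tau c = al, hess_tau c = be, disc c = de
              & 54%:R^-1 * jacobian_tau c = ga].
Proof.
have nzM a b : (2 ^ a * 3 ^ b)%:R != 0 :> K.
  by rewrite natrM !natrX mulf_neq0 ?expf_neq0.
have nz8 : 8%:R != 0 :> K := nzM 3 0.
have nz54 : 54%:R != 0 :> K := nzM 1 3.
have nz4 : 4%:R != 0 :> K := nzM 2 0.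
have nz27 : 27%:R != 0 :> K := nzM 0 3.
move=> syz; have [al0|al0] := eqVneq al 0; last first.
  have [c [[cA cB cC cD] [t0 t1]]] := coords_of_cubic_tau
    (- al / 8%:R) 0 (- (2%:R * be) / (3%:R * al)) (32%:R * ga / al ^+ 2) 1 0.
  exists c.
  have E1 : - 8%:R * cubic_tau c = al.
    rewrite /cubic_tau /cubic t0 t1 cA cB cC cD; field.
    by apply/and3P.
  have E2 : hess_tau c = be.
    rewrite /hess_tau /hess /hess0 /hess1 /hess2 t0 t1 cA cB cC cD; field.
    by apply/and3P.
  have E4 : 54%:R^-1 * jacobian_tau c = ga.
    rewrite /jacobian_tau /jacobian /cubic_x /cubic_y /hess_x /hess_y.
    rewrite /hess0 /hess1 /hess2 t0 t1 cA cB cC cD; field.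
    by apply/and4P.
  (* The syzygy determines the discriminant since [al] is nonzero. *)
  split=> //; apply: (mulfI nz27); apply: (mulIf (expf_neq0 2 al0)).
  have := eisenstein_relation c; rewrite E1 E2 E4 -syz => /addIr /addIr.
  exact.
rewrite {}al0 expr0n mulr0 add0r in syz *.
have [be0|be0] := eqVneq be 0; last first.
  (* With [tau = (1, 0)] the cubic [s x^2 y + D y^3] has Hessian [- 4 s^2] and
     Jacobian [8 s^3] at [tau]; the quotient of these values gives [s]. *)
  set s := - (27%:R * ga) / be.
  have s2 : - (4%:R * s ^+ 2) = be.
    apply: (mulIf (expf_neq0 2 be0)).
    apply: (mulfI nz4); apply/eqP; rewrite -subr_eq0 -oppr_eq0 -syz natrM !natrX.
    rewrite /s; apply/eqP; field.
    exact: be0.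
  have s0 : s != 0.
    by apply: contraNneq be0 => s0; rewrite -s2 s0 expr0n mulr0 oppr0.
  have [c [[cA cB cC cD] [t0 t1]]] := coords_of_cubic_tau
    0 s 0 (- de / (4%:R * s ^+ 3)) 1 0.
  exists c; split.
  - by rewrite /cubic_tau /cubic t0 t1 cA; ring.
  - by rewrite -s2 /hess_tau /hess /hess0 t0 t1 cA cB cC; ring.
  - rewrite /disc cA cB cC cD; field.
    by apply/andP.
  have gaE : ga = - (s * be) / 27%:R.
    by rewrite /s; field; apply/andP.
  rewrite gaE -s2 /jacobian_tau /jacobian /cubic_x /cubic_y /hess_x /hess_y.
  rewrite /hess0 /hess1 /hess2 t0 t1 cA cB cC cD; field.
  by apply/and4P.
rewrite {}be0 expr0n mulr0 add0r in syz *.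
have ga0 : ga = 0.
  by apply/eqP; move/eqP: syz; rewrite mulf_eq0 (negPf (nzM 4 6)) sqrf_eq0.
have [c [[cA cB cC cD] [t0 t1]]] := coords_of_cubic_tau
  0 1 0 (- de / 4%:R) 0 0.
exists c; split.
- by rewrite /cubic_tau /cubic t0 t1; ring.
- by rewrite /hess_tau /hess t0 t1; ring.
- by rewrite /disc cA cB cC cD; field.
by rewrite ga0 /jacobian_tau /jacobian /cubic_x /cubic_y t0 t1; ring.
Qed.
End PrescribedValues.

(** * The action in coordinates *)

Section BasisCoordinates.
Variables (F : fieldType) (V : vectType F) (e : 2.-tuple V).
Hypothesis he : basis_of fullv e.
Implicit Types (m : V -> V -> V) (g : 'End(V)) (c : 'I_6 -> F).
Local Notation e0 := (tnth e 0).
Local Notation e1 := (tnth e 1).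

Lemma coord_tnth (i j : 'I_2) : coord e i (tnth e j) = (j == i)%:R.
Proof. by rewrite (tnth_nth 0) coord_free // (basis_free he). Qed.

Lemma basis_expansion v : v = coord e 0 v *: e0 + coord e 1 v *: e1.
Proof.
rewrite [LHS](coord_basis he (memvf v)) !big_ord_recl big_ord0 addr0.
by rewrite !(tnth_nth 0); congr (_ + coord _ _ _ *: _); exact/val_inj.
Qed.

Definition lincomb (x y : F) : V := x *: e0 + y *: e1.

Lemma coord0_lincomb x y : coord e 0 (lincomb x y) = x.
Proof. by rewrite linearD !linearZ /= !coord_tnth /= mulr1 mulr0 addr0. Qed.

Lemma coord1_lincomb x y : coord e 1 (lincomb x y) = y.
Proof. by rewrite linearD !linearZ /= !coord_tnth /= mulr1 mulr0 add0r. Qed.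

Lemma eq_coord v w : coord e 0 v = coord e 0 w -> coord e 1 v = coord e 1 w -> v = w.
Proof. by move=> E0 E1; rewrite (basis_expansion v) E0 E1 -basis_expansion. Qed.

Lemma bilinear_lincomb m x y z u : Ac m ->
  m (lincomb x y) (lincomb z u) =
  (x * z) *: m e0 e0 + (x * u + y * z) *: m e0 e1 + (y * u) *: m e1 e1.
Proof.
move=> [[lin1 lin2] sym].
have mDl u1 u2 w k l : m (k *: u1 + l *: u2) w = k *: m u1 w + l *: m u2 w.
  have lin1_0 : m 0 w = 0.
    by have := lin1 w (-1) 0 0; rewrite scaler0 addr0 /= scaleN1r addNr.
  rewrite [LHS](lin1 w) /=; congr (_ + _).
  by rewrite -[l *: u2 in LHS]addr0 [LHS](lin1 w) /= lin1_0 addr0.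
rewrite /lincomb mDl ![m _ (_ + _)]sym !mDl (sym e1 e0).
by apply: eq_coord; rewrite !(linearD, linearZ) /=; ring.
Qed.

Definition linear_mx (p q r s : F) (v : V) : V :=
  lincomb (p * coord e 0 v + q * coord e 1 v) (r * coord e 0 v + s * coord e 1 v).

Fact linear_mx_is_linear p q r s : linear (linear_mx p q r s).
Proof.
move=> k v w; rewrite /linear_mx; apply: eq_coord; rewrite [RHS]linearP /=.
  by rewrite !coord0_lincomb !linearP /=; ring.
by rewrite !coord1_lincomb !linearP /=; ring.
Qed.

HB.instance Definition _ p q r s :=
  GRing.isLinear.Build F V V *:%R (linear_mx p q r s) (linear_mx_is_linear p q r s).

Definition algebra_of_coord c (v w : V) : V :=
  let x := coord e 0 v * coord e 0 w in
  let y := coord e 0 v * coord e 1 w + coord e 1 v * coord e 0 w in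
  let z := coord e 1 v * coord e 1 w in
  lincomb (x * c 0 + y * c 4%:R + z * c 2%:R) (x * c 1 + y * c 5%:R + z * c 3%:R).

Lemma Ac_algebra_of_coord c : Ac (algebra_of_coord c).
Proof.
split=> [|v w]; last by rewrite /algebra_of_coord; congr lincomb; ring.
split=> w k u v /=; rewrite /algebra_of_coord; apply: eq_coord;
  rewrite [RHS]linearP /=.
- by rewrite !coord0_lincomb !linearP /=; ring.
- by rewrite !coord1_lincomb !linearP /=; ring.
- by rewrite !coord0_lincomb !linearP /=; ring.
- by rewrite !coord1_lincomb !linearP /=; ring.
Qed.

Lemma algebra_of_coordK c : Ac_coord e (algebra_of_coord c) = c.
Proof.
apply: eq_fun6; rewrite /Ac_coord tnth6E.
- by rewrite /coef_a coord0_lincomb !coord_tnth /=; ring.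
- by rewrite /coef_b coord1_lincomb !coord_tnth /=; ring.
- by rewrite /coef_c coord0_lincomb !coord_tnth /=; ring.
- by rewrite /coef_d coord1_lincomb !coord_tnth /=; ring.
- by rewrite /coef_e coord0_lincomb !coord_tnth /=; ring.
- by rewrite /coef_f coord1_lincomb !coord_tnth /=; ring.
Qed.

Definition gcoef g i j := coord e i (g (tnth e j)).

Lemma SLE g : SL e g <-> gcoef g 0 0 * gcoef g 1 1 - gcoef g 1 0 * gcoef g 0 1 = 1.
Proof.
rewrite /SL /= (expand_det_row _ 0) !big_ord_recl big_ord0 /cofactor.
rewrite !det_mx11 !mxE /=.
rewrite -!/(gcoef _ _ _).
rewrite (_ : lift 0 0 = 1 :> 'I_2); last exact/val_inj.
rewrite (_ : lift 1 0 = 0 :> 'I_2); last exact/val_inj.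
by rewrite expr0 expr1 mul1r mulN1r addr0 mulrN (mulrC (gcoef g 0 1)).
Qed.

Lemma lfun_lincomb g x y :
  g (lincomb x y) = lincomb (gcoef g 0 0 * x + gcoef g 0 1 * y)
                            (gcoef g 1 0 * x + gcoef g 1 1 * y).
Proof.
apply: eq_coord; rewrite ?coord0_lincomb ?coord1_lincomb linearD !linearZ /=.
  by rewrite linearD !linearZ /= -!/(gcoef _ _ _) !(mulrC (gcoef _ _ _)).
by rewrite linearD !linearZ /= -!/(gcoef _ _ _) !(mulrC (gcoef _ _ _)).
Qed.

Lemma SL_inv g x y : SL e g ->
  (g^-1)%VF (lincomb x y) = lincomb (gcoef g 1 1 * x - gcoef g 0 1 * y)
                            (gcoef g 0 0 * y - gcoef g 1 0 * x).
Proof.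
move=> /SLE det1.
have det1' : gcoef g 0 0 * gcoef g 1 1 = 1 + gcoef g 1 0 * gcoef g 0 1.
  by rewrite -det1 subrK.
have g_inj : lker g == 0%VS.
  apply/lker0P => v w; rewrite (basis_expansion v) (basis_expansion w).
  rewrite -!/(lincomb _ _) !lfun_lincomb => E.
  have := congr1 (coord e 0) E; have := congr1 (coord e 1) E.
  rewrite !coord0_lincomb !coord1_lincomb.
  move: (coord e 0 v) (coord e 1 v) (coord e 0 w) (coord e 1 w) => v0 v1 w0 w1 E1 E0.
  congr lincomb; rewrite -[LHS]mul1r -[RHS]mul1r -det1.
  - transitivity (gcoef g 1 1 * (gcoef g 0 0 * v0 + gcoef g 0 1 * v1)
            - gcoef g 0 1 * (gcoef g 1 0 * v0 + gcoef g 1 1 * v1)); first by ring.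
    by rewrite E0 E1; ring.
  - transitivity (gcoef g 0 0 * (gcoef g 1 0 * v0 + gcoef g 1 1 * v1)
            - gcoef g 1 0 * (gcoef g 0 0 * v0 + gcoef g 0 1 * v1)); first by ring.
    by rewrite E0 E1; ring.
apply: (lker0P g_inj).
rewrite [LHS](@lker0_lfunVK _ _ _ g_inj) lfun_lincomb.
by congr lincomb; ring: det1'.
Qed.

(** The structure constants of the transformed algebra are those of [m] in the
    basis formed by the images of the basis vectors under the inverse of [g],
    whence the entries of the adjugate. *)
Lemma Ac_coord_act g m : SL e g -> Ac m ->
  Ac_coord e (act g m) =
  change_basis (gcoef g 1 1) (- gcoef g 1 0) (- gcoef g 0 1) (gcoef g 0 0)
    (Ac_coord e m).
Proof.
move=> SLg Am; have e0E : e0 = lincomb 1 0 by rewrite /lincomb scale1r scale0r addr0.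
have e1E : e1 = lincomb 0 1 by rewrite /lincomb scale1r scale0r add0r.
have inv0 : (g^-1)%VF e0 = lincomb (gcoef g 1 1) (- gcoef g 1 0).
  by rewrite e0E SL_inv // !mulr1 !mulr0 subr0 sub0r.
have inv1 : (g^-1)%VF e1 = lincomb (- gcoef g 0 1) (gcoef g 0 0).
  by rewrite e1E SL_inv // !mulr1 !mulr0 subr0 sub0r.
have gE v : g v = lincomb (gcoef g 0 0 * coord e 0 v + gcoef g 0 1 * coord e 1 v)
                          (gcoef g 1 0 * coord e 0 v + gcoef g 1 1 * coord e 1 v).
  by rewrite {1}(basis_expansion v) -lfun_lincomb.
apply: eq_fun6; rewrite /change_basis /Ac_coord !tnth6E.
all: rewrite /coef_a /coef_b /coef_c /coef_d /coef_e /coef_f /act ?inv0 ?inv1.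
all: rewrite bilinear_lincomb // gE ?coord0_lincomb ?coord1_lincomb.
all: rewrite !(linearD, linearZ) /=.
all: move: (coord e 0 (m e0 e0)) (coord e 0 (m e0 e1)) (coord e 0 (m e1 e1)).
all: move: (coord e 1 (m e0 e0)) (coord e 1 (m e0 e1)) (coord e 1 (m e1 e1)).
all: by move=> *; ring.
Qed.

Lemma SL_exists x y z u : x * u - y * z = 1 -> exists g, SL e g /\
  forall m, Ac m -> Ac_coord e (act g m) = change_basis x y z u (Ac_coord e m).
Proof.
move=> det1; pose g : 'End(V) := linfun (linear_mx u (- z) (- y) x).
have g00 : gcoef g 0 0 = u.
  by rewrite /gcoef lfunE /= coord0_lincomb !coord_tnth /=; ring.
have g01 : gcoef g 0 1 = - z.
  by rewrite /gcoef lfunE /= coord0_lincomb !coord_tnth /=; ring.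
have g10 : gcoef g 1 0 = - y.
  by rewrite /gcoef lfunE /= coord1_lincomb !coord_tnth /=; ring.
have g11 : gcoef g 1 1 = x.
  by rewrite /gcoef lfunE /= coord1_lincomb !coord_tnth /=; ring.
have SLg : SL e g by apply/SLE; rewrite g00 g01 g10 g11 -det1; ring.
exists g; split=> // m Am.
by rewrite Ac_coord_act // g00 g01 g10 g11 !opprK.
Qed.

(** Invariance in terms of structure constants alone, so that invariance over
    the ground field and over a closure can be handled alike. *)
Lemma SL_invariantP (P : {mpoly F[6]}) :
  SL_invariant e P <-> forall x y z u c, x * u - y * z = 1 ->
    P.@[change_basis x y z u c] = P.@[c].
Proof.
split=> [invP x y z u c det1 | invP g m SLg Am].
  have [g [SLg gE]] := SL_exists det1.
  have Am := Ac_algebra_of_coord c.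
  by have := invP g _ SLg Am; rewrite gE // algebra_of_coordK.
rewrite Ac_coord_act //; apply: invP.
by move/SLE: SLg => <-; ring.
Qed.

Lemma SL_id : SL e \1%VF.
Proof. by apply/SLE; rewrite /gcoef !id_lfunE !coord_tnth /= mulr1 mulr0 subr0. Qed.

Lemma act_id m : act \1%VF m = m.
Proof.
have idV (v : V) : (\1^-1)%VF v = v.
  have id_inj : lker (\1%VF : 'End(V)) == 0%VS.
    by apply/lker0P => v1 v2; rewrite !id_lfunE.
  by have := lker0_lfunVK id_inj v; rewrite id_lfunE.
by apply/funext => v; apply/funext => w; rewrite /act id_lfunE !idV.
Qed.
End BasisCoordinates.

(** * The invariants as homogeneous polynomials *)

Section Naturality.
Variables (R S : comNzRingType) (f : {rmorphism R -> S}) (c : 'I_6 -> R).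
Let fc i := f (c i).

Lemma rmorph_cubic_tau : f (cubic_tau c) = cubic_tau fc.
Proof.
by rewrite /cubic_tau /cubic /cubA /cubB /cubC /cubD /tau0 /tau1
  !(rmorph_nat, rmorphD, rmorphN, rmorphM, rmorphXn).
Qed.

Lemma rmorph_hess_tau : f (hess_tau c) = hess_tau fc.
Proof.
rewrite /hess_tau /hess /hess0 /hess1 /hess2.
by rewrite /cubA /cubB /cubC /cubD /tau0 /tau1
  !(rmorph_nat, rmorphD, rmorphN, rmorphM, rmorphXn).
Qed.

Lemma rmorph_jacobian_tau : f (jacobian_tau c) = jacobian_tau fc.
Proof.
rewrite /jacobian_tau /jacobian /cubic_x /cubic_y /hess_x /hess_y.
rewrite /hess0 /hess1 /hess2.
by rewrite /cubA /cubB /cubC /cubD /tau0 /tau1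
  !(rmorph_nat, rmorphD, rmorphN, rmorphM, rmorphXn).
Qed.

Lemma rmorph_disc : f (disc c) = disc fc.
Proof.
by rewrite /disc /cubA /cubB /cubC /cubD
  !(rmorph_nat, rmorphD, rmorphN, rmorphM, rmorphXn).
Qed.
End Naturality.

(** The generic vector of structure constants: evaluating a formula at it gives
    the polynomial function that the formula defines. *)
Definition coordX (F : fieldType) (i : 'I_6) : {mpoly F[6]} := 'X_i.

Section Homogeneity.
Variable F : fieldType.
Local Notation X := (@coordX F).

Lemma homogX i : X i \is 1.-homog.
Proof. by rewrite dhomogX /= mdeg1. Qed.

Lemma homog_nat k : k%:R \is [in F[6], 0.-homog].
Proof. by rewrite rpredMn // dhomog1. Qed.

Lemma homog_eq d d' (p : {mpoly F[6]}) : p \is d.-homog -> d = d' -> p \is d'.-homog.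
Proof. by move=> + <-. Qed.

Ltac homog_monomial :=
  first [ eassumption | apply: homog_nat | apply: homogX
        | eapply dhomogM; homog_monomial | eapply dhomogMn; homog_monomial ].
Ltac homogeneous :=
  repeat first [apply: rpredD | apply: rpredB | rewrite rpredN];
  (eapply homog_eq; [homog_monomial | reflexivity]).

Lemma homog_coefs :
  [/\ cubA X \is 1.-homog, cubB X \is 1.-homog, cubC X \is 1.-homog
    & cubD X \is 1.-homog]
  /\ tau0 X \is 1.-homog /\ tau1 X \is 1.-homog.
Proof.
rewrite /cubA /cubB /cubC /cubD /tau0 /tau1.
by split; split; homogeneous.
Qed.

Lemma homog_hess_coefs :
  [/\ hess0 X \is 2.-homog, hess1 X \is 2.-homog & hess2 X \is 2.-homog].
Proof.
have [[hA hB hC hD] _] := homog_coefs.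
by rewrite /hess0 /hess1 /hess2; split; homogeneous.
Qed.

Lemma homog_cubic_tau : cubic_tau X \is 4.-homog.
Proof.
have [[hA hB hC hD] [h0 h1]] := homog_coefs.
by rewrite /cubic_tau /cubic; homogeneous.
Qed.

Lemma homog_hess_tau : hess_tau X \is 4.-homog.
Proof.
have [_ [t0 t1]] := homog_coefs; have [h0 h1 h2] := homog_hess_coefs.
by rewrite /hess_tau /hess; homogeneous.
Qed.

Lemma homog_disc : disc X \is 4.-homog.
Proof.
have [[hA hB hC hD] _] := homog_coefs.
by rewrite /disc; homogeneous.
Qed.

Lemma homog_jacobian_tau : jacobian_tau X \is 6.-homog.
Proof.
have [[hA hB hC hD] [t0 t1]] := homog_coefs; have [h0 h1 h2] := homog_hess_coefs.
rewrite /jacobian_tau /jacobian.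
have qx : cubic_x X (tau0 X) (tau1 X) \is 3.-homog by rewrite /cubic_x; homogeneous.
have qy : cubic_y X (tau0 X) (tau1 X) \is 3.-homog by rewrite /cubic_y; homogeneous.
have hx : hess_x X (tau0 X) (tau1 X) \is 3.-homog by rewrite /hess_x; homogeneous.
have hy : hess_y X (tau0 X) (tau1 X) \is 3.-homog by rewrite /hess_y; homogeneous.
by homogeneous.
Qed.
End Homogeneity.

Lemma std_basisP (K : fieldType) : basis_of fullv (std_basis K).
Proof.
have free_std : free (std_basis K).
  apply/freeP => k E i.
  have := congr1 (fun M : 'rV[K]_2 => M 0 i) E.
  rewrite !big_ord_recl big_ord0 /= !mxE /= addr0.
  case: i => [[|[|//]] i2] /=.
    by rewrite mulr1 mulr0 addr0 => <-; congr k; exact/val_inj.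
  by rewrite mulr1 mulr0 add0r => <-; congr k; exact/val_inj.
by rewrite basisEfree free_std subvf dimvf /dim.
Qed.

(** The formula [phi] is required over all rings at once: over polynomials it
    gives the polynomial that witnesses stability, and over the closures it
    gives the invariance of that polynomial after extension of scalars. *)
Section Stability.
Variables (F : fieldType) (V : vectType F) (e : 2.-tuple V).
Hypothesis he : basis_of fullv e.
Variable phi : forall R : comNzRingType, ('I_6 -> R) -> R.
Hypothesis phi_natural : forall (R S : comNzRingType) (f : {rmorphism R -> S}) c,
  f (phi c) = phi (fun i => f (c i)).
Hypothesis phi_inv : forall (R : comNzRingType) (x y z u : R) c,
  x * u - y * z = 1 -> phi (change_basis x y z u c) = phi c.
Variable n : nat.
Hypothesis phi_homog : phi (@coordX F) \is n.+1.-homog.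

Lemma meval_phi (K : fieldType) v : (phi (@coordX K)).@[v] = phi v.
Proof.
rewrite (phi_natural (meval v)); congr phi; apply/funext => i.
exact: mevalXU.
Qed.

Lemma stable_of_invariant m : Ac m -> phi (Ac_coord e m) != 0 -> Ac_st e m.
Proof.
move=> Am nz; split=> //; exists n.+1, (phi (@coordX F)).
split=> //; last by rewrite meval_phi.
split=> [|K iota _].
  by apply/(SL_invariantP he) => *; rewrite !meval_phi phi_inv.
apply/(SL_invariantP (std_basisP K)) => *.
rewrite (phi_natural (map_mpoly iota)).
rewrite (_ : (fun i => _) = @coordX K) ?meval_phi ?phi_inv //.
by apply/funext => i; exact: map_mpolyX.
Qed.
End Stability.

(** * Vanishing of invariant polynomials on null forms *)

Section Unstable.
Variable K : fieldType.

(** Infinitude of [K], in the form in which a one-parameter subgroup uses it: a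
    polynomial identity on the multiplicative group is a formal one. *)
Definition infinite_field :=
  forall p : {poly K}, (forall t, t != 0 -> p.[t] = 0) -> p = 0.

Lemma meval0_homog k n (P : {mpoly K[k]}) : P \is n.+1.-homog -> P.@[fun=> 0] = 0.
Proof.
move=> homP; rewrite mevalE big_seq big1 // => m mP.
have := dhomog_mf homP mP; rewrite /= mdegE => sum_m.
have [i mi] : exists i, m i != 0%N.
  apply/existsP; apply: contraPT sum_m; rewrite negb_exists => /forallP m0.
  by rewrite big1 // => i _; apply/eqP; move: (m0 i); rewrite negbK.
by rewrite (bigD1 i) //= expr0n (negPf mi) mul0r mulr0.
Qed.

(** If all weights of a one-parameter group on a point are positive, then zero
    lies in the closure of the orbit: the value along the orbit is polynomial
    in [t], constant for nonzero [t], and zero at [t = 0]. *)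
Lemma vanish_of_scaling k n (P : {mpoly K[k]}) (c : 'I_k -> K) (w : 'I_k -> nat) :
  infinite_field -> P \is n.+1.-homog ->
  (forall t, t != 0 -> P.@[fun i => c i * t ^+ (w i).+1] = P.@[c]) -> P.@[c] = 0.
Proof.
move=> infK homP inv.
pose r : {poly K} :=
  \sum_(m <- msupp P) P@_m *: \prod_i (c i *: 'X ^+ (w i).+1) ^+ m i.
have rE t : r.[t] = P.@[fun i => c i * t ^+ (w i).+1].
  rewrite mevalE horner_sum; apply: eq_bigr => m _; rewrite hornerZ horner_prod.
  by congr (_ * _); apply: eq_bigr => i _; rewrite !hornerE.
have /eqP : r - P.@[c]%:P = 0.
  by apply: infK => t t0; rewrite !hornerE rE inv // subrr.
rewrite subr_eq0 => /eqP r_const; have := rE 0; rewrite r_const hornerC => ->.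
rewrite -[RHS](meval0_homog homP); apply: meval_eq => i.
by rewrite expr0n mulr0.
Qed.

Lemma null_form_unstable n (P : {mpoly K[6]}) c :
  infinite_field -> P \is n.+1.-homog ->
  (forall x y z u c, x * u - y * z = 1 -> P.@[change_basis x y z u c] = P.@[c]) ->
  c 0 = 0 -> c 1 = 0 -> c 5%:R = 0 -> P.@[c] = 0.
Proof.
move=> infK homP inv c0 c1 c5.
(* Predecessors of the weights: c has weight 3, d and e have weight 1,
   and a, b, f are zero. *)
pose w : 'I_6 -> nat := tnth [tuple 0; 0; 2; 0; 0; 0]%N.
apply: (vanish_of_scaling (w := w) infK homP) => t t0.
rewrite -(inv t^-1 0 0 t c) ?mulVf ?mulr0 ?subr0 //; apply: meval_eq.
suff -> : (fun i => c i * t ^+ (w i).+1) = change_basis t^-1 0 0 t c by [].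
by apply: eq_fun6; rewrite /change_basis /w !tnth6E ?c0 ?c1 ?c5; field.
Qed.

Lemma unstable_of_invariants0 n (P : {mpoly K[6]}) c :
  2%:R != 0 :> K -> 3%:R != 0 :> K ->
  infinite_field -> P \is n.+1.-homog ->
  (forall x y z u c, x * u - y * z = 1 -> P.@[change_basis x y z u c] = P.@[c]) ->
  cubic_tau c = 0 -> hess_tau c = 0 -> disc c = 0 -> P.@[c] = 0.
Proof.
move=> nz2 nz3 infK homP inv q0 h0 d0.
have [x [y [z [u [det1 [c0 c1 c5]]]]]] := null_form nz2 nz3 q0 h0 d0.
by rewrite -(inv x y z u c det1); exact: (null_form_unstable infK homP inv).
Qed.
End Unstable.

(** Otherwise [p X + 1] would be a nonconstant polynomial without roots. *)
Lemma closed_infinite (K : closedFieldType) : infinite_field K.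
Proof.
move=> p p0; apply/eqP/negPn/negP => nz.
have : size (p * 'X + 1%:P) != 1%N.
  by rewrite size_MXaddC oner_eq0 andbF eqSS size_poly_eq0.
case/closed_rootP => t; rewrite rootE !hornerE.
have [->|t0] := eqVneq t 0; first by rewrite mulr0 add0r oner_eq0.
by rewrite p0 // mul0r add0r oner_eq0.
Qed.

Lemma infinite_or_enumerated (F : fieldType) :
  infinite_field F \/ exists s : seq F, forall x, x \in s.
Proof.
have [fin|inf] := pselect (exists s : seq F, forall x, x \in s); first by right.
left=> p p0; apply/eqP/negPn/negP => nz.
have big k : exists s : seq F, uniq s /\ size s = k.
  elim: k => [|k [s [us sk]]]; first by exists [::].
  have [x xs] : exists x, x \notin s.
    apply: contrapT => none; apply: inf; exists s => x.
    by apply/negPn/negP => xs; apply: none; exists x.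
  by exists (x :: s); rewrite /= xs us sk.
have [s [us ss]] := big (size ('X * p)).
have := max_poly_roots (p := 'X * p) (rs := s); rewrite ss ltnn => no_roots.
suff: false by []; apply: no_roots => //.
  by rewrite mulf_neq0 ?polyX_eq0.
apply/allP => t _; rewrite rootE !hornerE.
by have [->|t0] := eqVneq t 0; rewrite ?mul0r // p0 // mulr0.
Qed.

(** An enumerated field is countable, and countable fields have an algebraic
    closure obtained without any choice of maximal extension. *)
Lemma finite_algebraic_closure (F : fieldType) (s : seq F) : (forall x, x \in s) ->
  exists (K : closedFieldType) (iota : {rmorphism F -> K}), integralRange iota.
Proof.
move=> sP.
have idxK : pcancel (index^~ s) (fun i => Some (nth 0 s i)).
  by move=> x; rewrite nth_index.
pose mx : isCountable F := PCanIsCountable idxK.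
pose CF : countFieldType := HB.pack F mx.
have [K [iota intK]] := countable_algebraic_closure CF.
by exists (K : closedFieldType), (iota : {rmorphism F -> K}).
Qed.

(** * The four invariants as scalars *)

Section FundamentalCubic.
Variables (F : fieldType) (V : vectType F) (e : 2.-tuple V) (m : V -> V -> V).
Local Notation c := (Ac_coord e m).
Local Notation X0 := ('X_0 : {mpoly F[2]}).
Local Notation X1 := ('X_1 : {mpoly F[2]}).

Lemma mderivXU n (R : comNzRingType) (i j : 'I_n) :
  ('X_j : {mpoly R[n]})^`M(i) = (j == i)%:R.
Proof.
rewrite mderivX mnm1E; have [->|_] := eqVneq j i; last by rewrite scale0r.
rewrite scale1r -[RHS]mpolyX0; congr 'X_[_].
by apply/mnmP => k; rewrite mnmBE mnm0E subnn.
Qed.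

Let mderivE := (mderivD, mderivZ, mderivM, mderivXU).

Lemma q_deriv0 : (q e m)^`M(0) = (3%:R * cubA c) *: X0 ^+ 2
  + (2%:R * cubB c) *: (X0 * X1) + cubC c *: X1 ^+ 2.
Proof.
rewrite /q -/(cubA c) -/(cubB c) -/(cubC c) -/(cubD c).
rewrite !exprS !expr0 !mulr1 !mderivE /= -!mul_mpolyC; ring.
Qed.

Lemma q_deriv1 : (q e m)^`M(1) = cubB c *: X0 ^+ 2
  + (2%:R * cubC c) *: (X0 * X1) + (3%:R * cubD c) *: X1 ^+ 2.
Proof.
rewrite /q -/(cubA c) -/(cubB c) -/(cubC c) -/(cubD c).
rewrite !exprS !expr0 !mulr1 !mderivE /= -!mul_mpolyC; ring.
Qed.

Lemma muE : mu e m = hess0 c *: X0 ^+ 2 + hess1 c *: (X0 * X1) + hess2 c *: X1 ^+ 2.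
Proof.
rewrite /mu q_deriv0 q_deriv1 !exprS !expr0 !mulr1 !mderivE /=.
by rewrite /hess0 /hess1 /hess2 -!mul_mpolyC; ring.
Qed.

Lemma mu_deriv0 : (mu e m)^`M(0) = (2%:R * hess0 c) *: X0 + hess1 c *: X1.
Proof.
rewrite muE !exprS !expr0 !mulr1 !mderivE /= -!mul_mpolyC; ring.
Qed.

Lemma mu_deriv1 : (mu e m)^`M(1) = hess1 c *: X0 + (2%:R * hess2 c) *: X1.
Proof.
rewrite muE !exprS !expr0 !mulr1 !mderivE /= -!mul_mpolyC; ring.
Qed.

Lemma q_tauE : (q e m).@[tau e m] = cubic_tau c.
Proof. by rewrite /q !(mevalD, mevalZ, mevalM, rmorphXn, mevalXU). Qed.

Lemma mu_tauE : (mu e m).@[tau e m] = hess_tau c.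
Proof. by rewrite muE !(mevalD, mevalZ, mevalM, rmorphXn, mevalXU). Qed.

Lemma G_tauE : (G e m).@[tau e m] = jacobian_tau c.
Proof.
rewrite /G q_deriv0 q_deriv1 mu_deriv0 mu_deriv1.
by rewrite !(mevalD, mevalN, mevalZ, mevalM, rmorphXn, mevalXU).
Qed.

Definition scaled_invariants (al be de ga : F) :=
  (Lscale al (omega_pow e 2), Lscale be (omega_pow e 2),
   Lscale de (omega_pow e 2), Lscale ga (omega_pow e 3)).

Lemma invariantsE : invariants e m =
  scaled_invariants (- 8%:R * cubic_tau c) (hess_tau c) (disc c)
                    (54%:R^-1 * jacobian_tau c).
Proof. by rewrite /invariants /p3 /p2 /DiscQ /Inv q_tauE mu_tauE G_tauE. Qed.
End FundamentalCubic.

(** * Tensor powers of the line of antisymmetric forms *)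

Section PowersOfL.
Variables (F : fieldType) (V : vectType F) (e : 2.-tuple V).
Hypothesis he : basis_of fullv e.
Local Notation e0 := (tnth e 0).
Local Notation e1 := (tnth e 1).

Lemma omega_basis : omega e e0 e1 = 1.
Proof. by rewrite /omega !coord_tnth //= mulr1 mulr0 subr0. Qed.

Lemma omega_pow_basis r : omega_pow e r (fun=> (e0, e1)) = 1.
Proof. by rewrite /omega_pow big1 // => i _; rewrite omega_basis. Qed.

Lemma Lpow_omega_pow r k : Lpow (Lscale k (omega_pow e r)).
Proof.
move=> u i B.
pose rest := \prod_(j < r | j != i) omega e (u j).1 (u j).2.
have BE v w : B v w = k * (omega e v w * rest).
  rewrite /B /Lscale /omega_pow (bigD1 i) //= eqxx; congr (_ * (_ * _)).
  by apply: eq_bigr => j /negPf ->.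
split=> [|v w]; last by rewrite !BE /omega; ring.
by split=> w l v v' /=; rewrite !BE /omega !linearP /=; ring.
Qed.

Hypothesis nz2 : 2%:R != 0 :> F.

(** Antisymmetric forms are alternating because 2 is invertible. *)
Lemma alternating_omega (B : V -> V -> F) :
  bilinear_for *%R *%R B -> (forall v w, B v w = - B w v) ->
  forall v w, B v w = omega e v w * B e0 e1.
Proof.
move=> [lin1 lin2] anti v w.
have BDl a b u1 u2 z : B (a *: u1 + b *: u2) z = a * B u1 z + b * B u2 z.
  have B0 : B 0 z = 0.
    by have := lin1 z (-1) 0 0; rewrite scaler0 addr0 /= mulN1r addNr.
  rewrite [LHS](lin1 z) /=; congr (_ + _).
  by rewrite -[b *: u2 in LHS]addr0 [LHS](lin1 z) /= B0 addr0.
have alt z : B z z = 0.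
  apply: (mulfI nz2); rewrite mulr0 mulrDl mul1r {1}anti; exact: addNr.
rewrite {1}(basis_expansion he v) {1}(basis_expansion he w) BDl.
rewrite ![B _ (_ + _)]anti !BDl !alt (anti e1 e0) /omega; ring.
Qed.

Lemma Lpow_step r (T : pairform V r) (u : 'I_r -> V * V) i : Lpow T ->
  T u = omega e (u i).1 (u i).2 * T [eta u with i |-> (e0, e1)].
Proof.
move=> /(_ u i) /= [lin anti]; rewrite -(alternating_omega lin anti).
by congr T; apply/funext => j /=; case: eqP => // ->; case: (u i).
Qed.

(** The arguments are replaced one pair after the other by [(e_1, e_2)], each
    replacement extracting one factor of the power of [omega]. *)
Lemma LpowP r (T : pairform V r) : Lpow T -> exists k, T = Lscale k (omega_pow e r).
Proof.
move=> LT; exists (T (fun=> (e0, e1))); apply/funext => u.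
have key (s : seq 'I_r) : uniq s -> T u =
    (\prod_(i <- s) omega e (u i).1 (u i).2)
    * T (fun j => if j \in s then (e0, e1) else u j).
  elim: s => [_|i s IHs /= /andP [iNs us]].
    by rewrite big_nil mul1r; congr T; apply/funext.
  rewrite IHs // big_cons (Lpow_step _ i LT) (negPf iNs) mulrA [X in X * _]mulrC.
  congr (_ * _); congr T; apply/funext => j /=; rewrite inE.
  by case: (j == i).
rewrite (key _ (index_enum_uniq _)) /Lscale /omega_pow mulrC; congr (T _ * _).
by apply/funext => j; rewrite mem_index_enum.
Qed.

Lemma Ltens_omega r s a b :
  Ltens (Lscale a (omega_pow e r)) (Lscale b (omega_pow e s))
  = Lscale (a * b) (omega_pow e (r + s)).
Proof.
apply/funext => u; rewrite /Ltens /Lscale /omega_pow big_split_ord /=.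
by rewrite mulrACA.
Qed.

Lemma Gamma_scaled al be de ga :
  Gamma_Eisenstein (scaled_invariants e al be de ga) <->
  ~ [/\ al = 0, be = 0, de = 0 & ga = 0] /\
  27%:R * de * al ^+ 2 + 4%:R * be ^+ 3 + (2 ^ 4 * 3 ^ 6)%:R * ga ^+ 2 = 0.
Proof.
have relE u :
  27%:R * Ltens (Ltens (Lscale de (omega_pow e 2)) (Lscale al (omega_pow e 2)))
                 (Lscale al (omega_pow e 2)) u
   + 4%:R * Ltens (Ltens (Lscale be (omega_pow e 2)) (Lscale be (omega_pow e 2)))
                 (Lscale be (omega_pow e 2)) u
   + (2 ^ 4 * 3 ^ 6)%:R * Ltens (Lscale ga (omega_pow e 3))
                                  (Lscale ga (omega_pow e 3)) u
   = (27%:R * de * al ^+ 2 + 4%:R * be ^+ 3 + (2 ^ 4 * 3 ^ 6)%:R * ga ^+ 2)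
     * omega_pow e 6 u.
  rewrite !Ltens_omega /Lscale.
  rewrite -![omega_pow e _ u]/(omega_pow e 6 u).
  by move: ((2 ^ 4 * 3 ^ 6)%:R) => k; ring.
have Lscale_eq0 r k : Lscale k (omega_pow e r) = cst 0 <-> k = 0.
  split=> [/(congr1 (fun T => T (fun=> (e0, e1)))) | ->].
    by rewrite /Lscale omega_pow_basis mulr1.
  by apply/funext => u; rewrite /Lscale mul0r.
split=> [[_ nz rel] | [nz rel]].
  split=> [[al0 be0 de0 ga0] | ].
    by apply: nz; rewrite al0 be0 de0 ga0; congr (_, _, _, _); apply/Lscale_eq0.
  by have := rel (fun=> (e0, e1)); rewrite relE omega_pow_basis mulr1.
split; first by split; exact: Lpow_omega_pow.
  by case=> /Lscale_eq0 ? /Lscale_eq0 ? /Lscale_eq0 ? /Lscale_eq0 ?; apply: nz.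
by move=> u; rewrite relE rel mul0r.
Qed.
End PowersOfL.

(** * Stable algebras and the hypersurface *)

Section ScalarExtension.
Variables (F K : fieldType) (iota : {rmorphism F -> K}).

Lemma meval_map_mpoly n (P : {mpoly F[n]}) v :
  (map_mpoly iota P).@[fun i => iota (v i)] = iota P.@[v].
Proof.
rewrite {1}(mpolyE P) [P.@[v]]mevalE [RHS]raddf_sum.
rewrite [map_mpoly iota _]raddf_sum [LHS]raddf_sum; apply: eq_bigr => m _ /=.
rewrite map_mpolyZ map_mpolyX mevalZ mevalX rmorphM rmorph_prod /=.
by congr (_ * _); apply: eq_bigr => i _; rewrite rmorphXn.
Qed.

Lemma homog_map_mpoly n d (P : {mpoly F[n]}) :
  P \is d.-homog -> map_mpoly iota P \is d.-homog.
Proof.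
move=> /dhomogP homP; apply/dhomogP => m.
by rewrite (perm_mem (msupp_map_mpoly _ (fmorph_inj iota))); apply: homP.
Qed.

Lemma natr_neq0_ext n : n%:R != 0 :> F -> n%:R != 0 :> K.
Proof. by rewrite -(rmorph_nat iota) fmorph_eq0. Qed.
End ScalarExtension.

Section StableAlgebras.
Variables (F : fieldType) (V : vectType F) (e : 2.-tuple V).
Hypothesis he : basis_of fullv e.
Hypotheses (nz2 : 2%:R != 0 :> F) (nz3 : 3%:R != 0 :> F).

(** Stability refers to closures of the ground field, and these are only needed
    when the ground field is finite. *)
Lemma stable_invariants_neq0 m : Ac_st e m ->
  ~ [/\ cubic_tau (Ac_coord e m) = 0, hess_tau (Ac_coord e m) = 0
      & disc (Ac_coord e m) = 0].
Proof.
case=> Am [[|n] [P [//= _ homP [invF invK] /eqP nzP]]] [q0 h0 d0]; apply: nzP.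
have [infF|[s sP]] := infinite_or_enumerated F.
  have inv := iffLR (SL_invariantP he _) invF.
  exact: (unstable_of_invariants0 nz2 nz3 infF homP inv).
have [K [iota int_iota]] := finite_algebraic_closure sP.
apply: (fmorph_inj iota); rewrite rmorph0 -meval_map_mpoly.
apply: (unstable_of_invariants0 _ _ (@closed_infinite K) (homog_map_mpoly iota homP)).
- exact: natr_neq0_ext iota _ nz2.
- exact: natr_neq0_ext iota _ nz3.
- exact: (iffLR (SL_invariantP (std_basisP K) _) (invK K iota int_iota)).
- by rewrite -(rmorph_cubic_tau iota) q0 rmorph0.
- by rewrite -(rmorph_hess_tau iota) h0 rmorph0.
- by rewrite -(rmorph_disc iota) d0 rmorph0.
Qed.

Lemma invariants_in_Gamma m : Ac_st e m -> Gamma_Eisenstein (invariants e m).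
Proof.
move=> stm; rewrite invariantsE; apply/(Gamma_scaled he).
split; last exact: eisenstein_relation.
have nz8 : - 8%:R != 0 :> F by rewrite oppr_eq0 (natrX _ 2 3) expf_neq0.
case=> /eqP; rewrite mulf_eq0 (negPf nz8) => /eqP q0 h0 d0 _.
exact: (stable_invariants_neq0 stm).
Qed.

Lemma stable_of_invariants_neq0 m : Ac m ->
  ~ [/\ cubic_tau (Ac_coord e m) = 0, hess_tau (Ac_coord e m) = 0,
        disc (Ac_coord e m) = 0 & jacobian_tau (Ac_coord e m) = 0] ->
  Ac_st e m.
Proof.
move=> Am nz; set c := Ac_coord e m in nz.
have [q0|q0] := eqVneq (cubic_tau c) 0; last first.
  apply: (stable_of_invariant he (@rmorph_cubic_tau) _ (homog_cubic_tau F) Am q0).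
  by move=> R x y z u c' /(invariants_change_basis c') [].
have [h0|h0] := eqVneq (hess_tau c) 0; last first.
  apply: (stable_of_invariant he (@rmorph_hess_tau) _ (homog_hess_tau F) Am h0).
  by move=> R x y z u c' /(invariants_change_basis c') [].
have [d0|d0] := eqVneq (disc c) 0; last first.
  apply: (stable_of_invariant he (@rmorph_disc) _ (homog_disc F) Am d0).
  by move=> R x y z u c' /(invariants_change_basis c') [].
have [j0|j0] := eqVneq (jacobian_tau c) 0; first by case: nz.
apply: (stable_of_invariant he (@rmorph_jacobian_tau) _ (homog_jacobian_tau F) Am j0).
by move=> R x y z u c' /(invariants_change_basis c') [].
Qed.

Lemma Gamma_surj z : Gamma_Eisenstein z -> exists2 m, Ac_st e m & invariants e m = z.
Proof.
case: z => [[[A B] D] C] Gz.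
have [[LA LB LD LC] _ _] := Gz.
have [al Aal] := LpowP he nz2 LA; have [be Bbe] := LpowP he nz2 LB.
have [de Dde] := LpowP he nz2 LD; have [ga Cga] := LpowP he nz2 LC.
subst A B D C; have [nz rel] := iffLR (Gamma_scaled he _ _ _ _) Gz.
have [c [cal cbe cde cga]] := eisenstein_surj nz2 nz3 rel.
exists (algebra_of_coord e c); last first.
  by rewrite invariantsE algebra_of_coordK // cal cbe cde cga.
apply: stable_of_invariants_neq0; first exact: Ac_algebra_of_coord.
rewrite algebra_of_coordK // => -[q0 h0 d0 j0]; apply: nz.
by rewrite -cal -cbe -cde -cga q0 h0 d0 j0 !mulr0.
Qed.

(** An algebra lies in its own orbit, so equal orbits contain each other's
    representatives. *)
Lemma invariants_SLorbit m m' : Ac m -> SLorbit e m = SLorbit e m' ->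
  invariants e m' = invariants e m.
Proof.
move=> Am eq_orbits; have : SLorbit e m' m'.
  by exists \1%VF; [exact: SL_id | exact: act_id].
rewrite -eq_orbits => -[g SLg <-]; rewrite !invariantsE Ac_coord_act //.
have det1 : gcoef e g 1 1 * gcoef e g 0 0 - - gcoef e g 1 0 * - gcoef e g 0 1 = 1.
  by rewrite mulrNN (mulrC (gcoef e g 1 1)); exact/SLE.
by have [-> -> -> ->] := invariants_change_basis (Ac_coord e m) det1.
Qed.
End StableAlgebras.

Theorem corollary7p7 (F : fieldType) (V : vectType F) (e : 2.-tuple V)
    (char_neq2 : 2%N \notin [pchar F]) (char_neq3 : 3%N \notin [pchar F])
    (e_basis : basis_of fullv e) :
  exists zeta : set (V -> V -> V) ->
                pairform V 2 * pairform V 2 * pairform V 2 * pairform V 3,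
    [/\ forall m : V -> V -> V, Ac_st e m ->
          zeta (SLorbit e m) = invariants e m,
        set_fun (Ac_st_quotient e) (@Gamma_Eisenstein F V) zeta
      & set_surj (Ac_st_quotient e) (@Gamma_Eisenstein F V) zeta].
Proof.
have nz2 : 2%:R != 0 :> F by move: char_neq2; rewrite inE.
have nz3 : 3%:R != 0 :> F by move: char_neq3; rewrite inE.
have zetaP (O : set (V -> V -> V)) : exists z, forall m,
    Ac_st e m -> SLorbit e m = O -> z = invariants e m.
  have [[m stm mO]|none] := pselect (exists2 m, Ac_st e m & SLorbit e m = O).
    exists (invariants e m) => m' [Am' _] m'O.
    by apply: (invariants_SLorbit e_basis Am'); rewrite m'O mO.
  exists (invariants e (fun=> 0)) => m stm mO.
  by case: none; exists m.
have [zeta zetaE] := choice zetaP.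
have zeta_orbit m : Ac_st e m -> zeta (SLorbit e m) = invariants e m.
  by move=> stm; apply: zetaE.
exists zeta; split=> // [_ [m stm <-]|z Gz].
  by rewrite zeta_orbit //; exact: invariants_in_Gamma.
have [m stm <-] := Gamma_surj e_basis nz2 nz3 Gz.
by exists (SLorbit e m); [exists m | rewrite zeta_orbit].
Qed.
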